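(* For all integers $n \geq g \geq 3$, there exists an oriented planar graph $D$ with exactly $n$ vertices and digirth $g$ such that the maximum size of an acyclic set in $D$ equals $$n-\left\lfloor\frac{n-1}{g-1}\right\rfloor = \left\lceil\frac{n(g-2)+1}{g-1}\right\rceil .$$
   Context: An oriented graph is a (finite) digraph without loops and multiple arcs; in particular, between any two distinct vertices there is at most one arc (no pair of opposite arcs). It is planar if its underlying undirected graph is planar. The digirth of a directed graph is the length (number of arcs) of a smallest directed cycle in it. An acyclic set in a digraph $D$ is a set of vertices of $D$ whose induced directed subgraph contains no directed cycle. *)

(* Defs.v *)
From HB Require Import structures.
From mathcomp Require Import all_boot all_order all_algebra.
From mathcomp Require Import all_classical all_reals all_analysis.

Set Implicit Arguments.
Unset Strict Implicit.
Unset Printing Implicit Defensive.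

Import Order.TTheory GRing.Theory Num.Theory.
Import numFieldNormedType.Exports.

(* A digraph without multiple arcs is a relation [e : rel V] on a finite type:
   [e u v] means that there is an arc from [u] to [v]. *)

Definition oriented (V : finType) (e : rel V) : Prop :=
  irreflexive e /\ forall u v : V, e u v -> ~~ e v u.

(* The vertices of [s], in cyclic order; its length is [size s]. *)
Definition dicycle (V : finType) (e : rel V) (s : seq V) : Prop :=
  0 < size s /\ ucycle e s.

Definition has_digirth (V : finType) (e : rel V) (g : nat) : Prop :=
  (exists s : seq V, dicycle e s /\ size s = g) /\
  (forall s : seq V, dicycle e s -> g <= size s).

Definition induced (V : finType) (e : rel V) (A : {set V}) : rel V :=
  [rel u v | [&& u \in A, v \in A & e u v]].

Definition acyclic_set (V : finType) (e : rel V) (A : {set V}) : Prop :=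
  forall s : seq V, ~ dicycle (induced e A) s.

Definition max_acyclic_size (V : finType) (e : rel V) (k : nat) : Prop :=
  (exists A : {set V}, acyclic_set e A /\ #|A| = k) /\
  (forall A : {set V}, acyclic_set e A -> #|A| <= k).

Definition underlying (V : finType) (e : rel V) : rel V :=
  [rel u v | e u v || e v u].

Local Open Scope classical_set_scope.
Local Open Scope ring_scope.

(* A drawing of a simple undirected graph, given by its symmetric adjacency
   relation [a], in the plane without crossings: [p] places the vertices and
   [c u v] is the arc from [p u] to [p v] drawn for the edge uv.  As (u, v) and
   (v, u) are the same edge, [c v u] is required to be [c u v] traversed
   backwards.  Values of [c u v] outside [0, 1], or for non-adjacent [u] and
   [v], are irrelevant. *)
Record plane_drawing (R : realType) (V : finType) (a : rel V)
    (p : V -> R * R) (c : V -> V -> R -> R * R) : Prop := PlaneDrawing {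
  drawing_vertex_inj : injective p ;
  drawing_continuous : forall u v : V, a u v ->
    {within `[0, 1]%classic, continuous (c u v)} ;
  drawing_simple : forall u v : V, a u v ->
    {in `[0, 1] &, injective (c u v)} ;
  drawing_ends : forall u v : V, a u v -> c u v 0 = p u /\ c u v 1 = p v ;
  drawing_rev : forall u v : V, a u v ->
    {in `[0, 1], forall t : R, c v u t = c u v (1 - t)} ;
  drawing_avoids_vertices : forall u v w : V, a u v ->
    {in `]0, 1[, forall t : R, c u v t <> p w} ;
  drawing_no_crossing : forall u v x y : V, a u v -> a x y ->
    (u, v) <> (x, y) -> (u, v) <> (y, x) ->
    {in `]0, 1[ &, forall s t : R, c u v s <> c x y t}
}.

Definition planar (R : realType) (V : finType) (e : rel V) : Prop :=
  exists (p : V -> R * R) (c : V -> V -> R -> R * R),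
    plane_drawing (underlying e) p c.

(* Main.v *)
(** Put G = g - 1 and cut 0, ..., n - 1 into consecutive layers of G vertices, the
    last one possibly incomplete.  Each layer is a directed path from its first
    vertex x to its last vertex y; with x', y' the ends of the next layer, there
    are moreover arcs from x' and y' to x and from y to x' and y'.

    A directed cycle contains the whole of the smallest layer that it meets,
    which is entered only at x and left only at y, and a vertex of a later layer.
    Hence the digirth is G + 1, and deleting x in each of the k = (n - 1) / G
    layers that have a successor leaves an acyclic set.  Conversely, let T meet
    all directed cycles.  By induction from the last layer, T has at least j
    vertices in the last j of these k layers and the remainder, and if it has
    exactly j there, then it misses an end of the first of them: were T to avoid
    the next layer downwards, that layer and the missed end would form a cycle.

    For planarity, number the ends of the layers x0, y0, x1, y1, ... and put the
    a-th one on the ray a mod 3 of three rays around the origin, at distance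
    a + 1; the inner vertices of a layer lie on the segment joining its ends.
    Only corners at most 3 apart are joined, and the segments in a wedge between
    two rays form a zigzag, so that the straight-line drawing has no crossing. *)

Require Import Defs.
From mathcomp Require Import all_boot all_order all_algebra.
From mathcomp Require Import all_classical all_reals all_analysis.
From mathcomp Require Import zify ring lra.

Set Implicit Arguments.
Unset Strict Implicit.
Unset Printing Implicit Defensive.

Import Order.TTheory GRing.Theory Num.Theory.
Import numFieldNormedType.Exports.

(** * Directed cycles of the layer digraph *)

(* The layer i consists of the m with m %/ G = i. *)
Definition layer_arc (G u v : nat) : bool :=
  [|| v == u.+1, (G %| u.+1) && (v == u + G), (G %| v) && (u == v + G)
    | (G %| v) && (u == v + (2 * G).-1)].

Definition layer_digraph (G n : nat) : rel 'I_n := fun u v => layer_arc G u v.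

Lemma layer_digraph_oriented (G n : nat) : 1 < G -> oriented (layer_digraph G (n := n)).
Proof.
move=> G1; split=> [u|u v]; rewrite /layer_digraph /layer_arc.
  by move: (G %| u) (G %| u.+1) => [] []; lia.
(* Opposite arcs would have to join some w and w + G with G dividing both w and w + 1. *)
have no (k : nat) : ~~ ((G %| k) && (G %| k.+1)).
  apply/negP => /andP[d]; rewrite -addn1 dvdn_addr // dvdn1 => /eqP G_1.
  by rewrite G_1 in G1.
have := no u; have := no v.
by move: (G %| u) (G %| v) (G %| u.+1) (G %| v.+1) {no} => [] [] [] [] /=; lia.
Qed.

Lemma dicycle_layer (G n : nat) (s : seq 'I_n) : 1 < G ->
  dicycle (layer_digraph G (n := n)) s ->
  exists i, (exists2 u, u \in s & i * G + G <= u) /\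
    forall j, j < G -> exists2 v, v \in s & v = i * G + j :> nat.
Proof.
move=> G1 [s0 /andP[cs us]].
have [x xs] : exists x, x \in s by case: s s0 {cs us} => // x s _; exists x; rewrite inE eqxx.
case: (arg_minnP (P := mem s) (@nat_of_ord n) xs) => m /= ms mmin.
have au : layer_arc G (prev s m) m by exact: (prev_cycle cs ms).
have us' : prev s m \in s by rewrite mem_prev.
have mu := mmin _ us'.
(* The arc entering the smallest vertex [m] descends, so [m] starts a layer and its predecessor lies
   beyond that layer. *)
have [dm um] : (G %| m) /\ m + G <= prev s m.
  move: au; rewrite /layer_arc.
  by move: (G %| m) (G %| (prev s m).+1) => [] []; split=> //; lia.
exists (m %/ G); rewrite divnK //; split; first by exists (prev s m).
elim=> [_|j IHj jG]; first by exists m; rewrite ?addn0.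
have [v vs vE] := IHj (ltnW jG).
have ns : next s v \in s by rewrite mem_next.
exists (next s v) => //; have := mmin _ ns.
have : layer_arc G v (next s v) by exact: (next_cycle cs vs).
rewrite /layer_arc vE.
(* Before the last vertex of the layer, every arc other than the one to the successor descends, here
   below the minimum [m]. *)
have : ~~ (G %| (m + j).+1).
  by rewrite -addnS dvdn_addr // gtnNdvd.
by move: (G %| _.+1) (G %| next s v) jG => [] []; clear; lia.
Qed.

Lemma path_arc_iota (G a m : nat) : path (layer_arc G) a (iota a.+1 m).
Proof.
elim: m a => //= m IHm a; rewrite IHm andbT; exact/orP/or_introl.
Qed.

Lemma last_iota (a m : nat) : last a (iota a.+1 m) = a + m.
Proof. by elim: m a => [|m IHm] a /=; rewrite ?addn0 // IHm addSnnS. Qed.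

(** If [z] is the first vertex of the next layer, its two arcs come from the first and third
    disjuncts of [layer_arc]; if it is the last one, from the second and fourth. *)
Lemma layer_cycle (G i z : nat) : 1 < G ->
  (z == i.+1 * G) || (z == i.+1 * G + G.-1) ->
  cycle (layer_arc G) (z :: iota (i * G) G).
Proof.
move=> G1 hz.
have -> : iota (i * G) G = i * G :: iota (i * G).+1 G.-1 by case: (G) G1.
rewrite /cycle rcons_path /= path_arc_iota last_iota andbT.
have d : G %| i * G by rewrite dvdn_mull.
have d' : G %| (i * G + G.-1).+1 by rewrite -addnS prednK ?dvdn_addr //; lia.
by rewrite /layer_arc d d'; move: (G %| z) (G %| z.+1) => [] []; lia.
Qed.

(** Through [P], the same cycle serves in the whole digraph and in the subgraph induced by the kept
    vertices. *)
Lemma layer_dicycle (G n i z : nat) (e : rel 'I_n.+1) (P : pred nat) : 1 < G ->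
  (z == i.+1 * G) || (z == i.+1 * G + G.-1) -> z <= n ->
  all P (z :: iota (i * G) G) ->
  (forall u v : 'I_n.+1, P u -> P v -> layer_arc G u v -> e u v) ->
  dicycle e (map inord (z :: iota (i * G) G)).
Proof.
move=> G1 hz zn aP Pe; split=> //.
have small x : x \in z :: iota (i * G) G -> x < n.+1.
  by rewrite inE mem_iota => /orP[/eqP->|]; lia.
apply/andP; split; last first.
  rewrite map_inj_in_uniq => [|x y xs ys /(congr1 val)]; last by rewrite /= !inordK ?small.
  by rewrite /= iota_uniq mem_iota andbT; lia.
have lc := layer_cycle (i := i) G1 hz.
apply: (homo_cycle_in (P := [pred x | (x < n.+1) && P x])) lc; last first.
  apply/allP => x xs; rewrite inE small //=; exact: (allP aP).
by move=> x y /andP[xn Px] /andP[yn Py] a; apply: Pe; rewrite !inordK.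
Qed.

Lemma layer_digraph_digirth (G n : nat) : 1 < G -> G < n ->
  has_digirth (layer_digraph G (n := n)) G.+1.
Proof.
case: n => // n G1 Gn; split.
  exists (map inord (G :: iota (0 * G) G)); split; last by rewrite size_map /= size_iota.
  apply: (layer_dicycle (P := xpredT)) => //; first by rewrite mul1n eqxx.
  exact: all_predT.
move=> s ds; have [i [[u us iu] h]] := dicycle_layer G1 ds.
rewrite -(size_map val).
(* The layer [i] and the later vertex [u] are already G + 1 distinct vertices of the cycle. *)
have -> : G.+1 = size (val u :: iota (i * G) G) by rewrite /= size_iota.
apply: uniq_leq_size; first by rewrite /= iota_uniq mem_iota; lia.
move=> x; rewrite inE mem_iota => /orP[/eqP->|xi]; first by rewrite mem_map //; exact: val_inj.
have [|v vs vE] := h (x - i * G); first lia.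
have -> : x = val v by rewrite /= vE; lia.
by rewrite mem_map //; exact: val_inj.
Qed.

(** * Sets of vertices meeting all directed cycles *)

(* [Q] is the set of deleted vertices: it must meet each cycle formed by a layer
   and an end [z] of the next one. *)
Lemma count_layers (G n k : nat) (Q : pred nat) : 1 < G -> k * G < n ->
  (forall i z, i < k -> (z == i.+1 * G) || (z == i.+1 * G + G.-1) -> z < n ->
     has Q (z :: iota (i * G) G)) ->
  k <= count Q (iota 0 n).
Proof.
move=> G1 kn H.
pose t i := count Q (iota (i * G) (n - i * G)).
suff inv j : j <= k -> j <= t (k - j) /\ (t (k - j) = j -> exists z,
    [/\ (z == (k - j) * G) || (z == (k - j) * G + G.-1), z < n & ~~ Q z]).
  by have [] := inv k (leqnn k); rewrite subnn /t mul0n subn0.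
elim: j => [_|j IHj jk].
  split=> //; rewrite /t subn0 => t0; exists (k * G); rewrite eqxx; split=> //.
  apply/negP => Qk; suff : has Q (iota (k * G) (n - k * G)) by rewrite has_count t0.
  by apply/hasP; exists (k * G) => //; rewrite mem_iota; lia.
have [tj zj] := IHj (ltnW jk).
have kjE : k - j = (k - j.+1).+1 by lia.
move: tj zj; rewrite kjE; set i := k - j.+1 => tj zj.
have ik : i < k by rewrite /i; lia.
have iG : i.+1 * G <= k * G by rewrite leq_mul2r ik orbT.
have tE : t i = count Q (iota (i * G) G) + t i.+1.
  rewrite /t (_ : n - i * G = G + (n - i.+1 * G)); last by rewrite mulSn in iG *; lia.
  by rewrite iotaD count_cat mulSn (addnC G).
have [hQ|hQ] := boolP (has Q (iota (i * G) G)); last first.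
  have c0 : count Q (iota (i * G) G) = 0 by apply/eqP; rewrite -leqn0 leqNgt -has_count.
  have : j < t i.+1.
    rewrite ltn_neqAle tj andbT; apply/eqP => jE.
    have [z [hz zn nQ]] := zj (esym jE).
    by have := H _ _ ik hz zn; rewrite /= (negbTE nQ) (negbTE hQ).
  rewrite tE c0; split=> // _; exists (i * G); rewrite eqxx; split=> //; first by lia.
  by apply: contra hQ => Qi; apply/hasP; exists (i * G) => //; rewrite mem_iota; lia.
move: (hQ); rewrite has_count => c1; split; first by rewrite tE; lia.
move=> tij.
(* Equality leaves only one deleted vertex in the layer [i], so one of its two distinct ends is
   kept. *)
have cE : count Q (iota (i * G) G) <= 1 by lia.
have [Q1|nQ1] := boolP (Q (i * G)); last by exists (i * G); rewrite eqxx; split=> //; lia.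
have [Q2|nQ2] := boolP (Q (i * G + G.-1)); last first.
  by exists (i * G + G.-1); rewrite eqxx orbT; split=> //; rewrite mulSn in iG; lia.
move: cE; rewrite [X in iota _ X](_ : G = 1 + (G - 2) + 1); last by lia.
rewrite !iotaD !count_cat /= Q1 (_ : i * G + (1 + (G - 2)) = i * G + G.-1); last by lia.
by rewrite Q2; lia.
Qed.

Lemma layer_digraph_max_acyclic (G n : nat) : 1 < G -> 0 < n ->
  max_acyclic_size (layer_digraph G (n := n)) (n - (n - 1) %/ G).
Proof.
case: n => // n G1 _; rewrite subn1 /=; set k := n %/ G.
have kn : k * G <= n by exact: leq_divM.
split; last first.
  move=> A acA; pose Q := [pred m : nat | inord m \notin A].
  suff kT : k <= #|~: A| by have := cardsC A; rewrite card_ord; lia.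
  have -> : #|~: A| = count Q (iota 0 n.+1).
    rewrite cardE /enum_mem size_filter -enumT -val_enum_ord count_map.
    by apply: eq_count => x /=; rewrite inE inord_val.
  apply: (count_layers G1) => // i z ik hz zn; apply/negPn/negP; rewrite -all_predC => aQ.
  apply: (acA (map inord (z :: iota (i * G) G))).
  apply: (layer_dicycle (P := predC Q)) => // u v.
  by rewrite /= !inord_val !negbK => uA vA uv; apply/and3P.
pose f (i : 'I_k) : 'I_n.+1 := inord (i * G).
have fE i : f i = i * G :> nat.
  rewrite /f inordK //; suff : i * G <= k * G by lia.
  by rewrite leq_mul2r ltnW ?orbT.
exists (~: [set f i | i : 'I_k]); split; last first.
  rewrite cardsCs finset.setCK card_ord card_imset ?card_ord // => i j /(congr1 val) /=.
  by rewrite !fE => /eqP; rewrite eqn_pmul2r; [move/eqP/val_inj|lia].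
move=> s [s0 /andP[cs us]].
have ds : dicycle (layer_digraph G (n := n.+1)) s.
  by split=> //; rewrite /ucycle us andbT; apply: sub_cycle cs => u v /and3P[].
have [i [[u us' iu] h]] := dicycle_layer G1 ds.
have [|v vs vE] := h 0; first lia.
(* As [u] lies beyond the layer [i], this layer has a successor, so its first vertex was deleted. *)
have ik : i < k by rewrite leq_divRL ?mulSn; [have := ltn_ord u|]; lia.
have /and3P[+ _ _] := next_cycle cs vs.
rewrite inE => /negP[]; apply/imsetP; exists (Ordinal ik) => //.
by apply: val_inj; rewrite /= fE /= vE addn0.
Qed.

(** With n = q G + r + 1 and 0 <= r < G, the numerator is G (n - q) - r. *)
Lemma ceil_formula (G n : nat) : 0 < G -> 0 < n ->
  ((n - (n - 1) %/ G)%N%:Z = Num.ceil ((n * (G - 1) + 1)%N%:R / G%:R : rat))%R.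
Proof.
move=> G0 n0; apply/esym/ceil_def.
set q := (n - 1) %/ G; have nE : n = q * G + (n - 1) %% G + 1 by rewrite -divn_eq; lia.
have := ltn_pmod (n - 1) G0; move: (_ %% _) nE => r nE rG.
have qn : q <= n by nia.
have GR : (0 < G%:R :> rat)%R by rewrite ltr0n.
rewrite -pmulrn natrB // -[(_ - 1)%R]/((n - q)%:Z - 1)%R rmorphB /= -pmulrn natrB //.
rewrite ltr_pdivlMr // ler_pdivrMr // natrD natrM natrB //.
have -> : (n%:R = q%:R * G%:R + r%:R + 1 :> rat)%R by rewrite nE !natrD natrM.
have : (r%:R + 1 <= G%:R :> rat)%R by rewrite natr1 ler_nat.
have : (0 <= r%:R :> rat)%R by [].
by move=> r0 rG'; apply/andP; split; lra.
Qed.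

(** * Straight-line drawings *)

Local Open Scope ring_scope.

Definition interp (R : realType) (P Q : R * R) (t : R) : R * R :=
  ((1 - t) * P.1 + t * Q.1, (1 - t) * P.2 + t * Q.2).

Lemma interp_rev (R : realType) (P Q : R * R) (t : R) :
  interp Q P t = interp P Q (1 - t).
Proof. by rewrite /interp; congr pair; ring. Qed.

Lemma interp_continuous (R : realType) (P Q : R * R) : continuous (interp P Q).
Proof.
have affine (x y : R) : continuous (fun t : R => (1 - t) * x + t * y).
  move=> t; apply: cvgD; apply: cvgM; try exact: cvg_cst; try exact: cvg_id.
  by apply: cvgB; [exact: cvg_cst|exact: cvg_id].
by move=> t; exact: (cvg_pair (affine _ _ t) (affine _ _ t)).
Qed.

Lemma interp_inj (R : realType) (P Q : R * R) : P <> Q -> injective (interp P Q).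
Proof.
move=> PQ s t [/eqP + /eqP].
rewrite -subr_eq0 => h1; rewrite -subr_eq0 => h2.
have : (s - t) * (Q.1 - P.1) = 0 by rewrite -(eqP h1); ring.
have : (s - t) * (Q.2 - P.2) = 0 by rewrite -(eqP h2); ring.
move=> /eqP; rewrite mulf_eq0 !subr_eq0 => /orP[/eqP//|/eqP e2] /eqP.
rewrite mulf_eq0 !subr_eq0 => /orP[/eqP//|/eqP e1].
by case: PQ; rewrite (surjective_pairing P) (surjective_pairing Q) e1 e2.
Qed.

(** One orientation of each edge suffices: reversing an edge replaces [t] by [1 - t]. *)
Lemma straight_line_planar (R : realType) (n : nat) (e : rel 'I_n) (p : 'I_n -> R * R) :
  irreflexive e -> injective p ->
  (forall (u v w : 'I_n) (t : R), (u < v)%N -> underlying e u v -> 0 < t < 1 ->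
     interp (p u) (p v) t <> p w) ->
  (forall (u v x y : 'I_n) (s t : R), (u < v)%N -> underlying e u v ->
     (x < y)%N -> underlying e x y -> 0 < s < 1 -> 0 < t < 1 ->
     interp (p u) (p v) s = interp (p x) (p y) t -> u = x /\ v = y) ->
  planar R e.
Proof.
move=> irr pinj pav pnc; exists p, (fun u v => interp (p u) (p v)).
have sym u v : underlying e u v -> underlying e v u by rewrite /underlying /= orbC.
have neq u v : underlying e u v -> u <> v by move=> /[swap] ->; rewrite /underlying /= irr.
have lt u v : underlying e u v -> (u < v)%N \/ (v < u)%N.
  move=> /neq uv; case: (ltngtP u v); [by left|by right|by move=> /val_inj].
have rev (t : R) : 0 < t < 1 -> 0 < 1 - t < 1 by lra.
split=> //.
- by move=> u v _; apply: continuous_subspaceT; exact: interp_continuous.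
- by move=> u v /neq uv s t _ _; apply: interp_inj => /pinj.
- by move=> u v _; rewrite /interp; split;
    rewrite !(subr0, subrr, mul1r, mul0r, addr0, add0r) -surjective_pairing.
- by move=> u v _ t _; rewrite interp_rev.
- move=> u v w uv t; rewrite in_itv /= => t01.
  have [|] := lt _ _ uv => l; first exact: pav.
  by rewrite interp_rev; apply: pav; [|exact: sym|exact: rev].
- move=> u v x y uv xy n1 n2 s t; rewrite !in_itv /= => s01 t01.
  have [luv|luv] := lt _ _ uv; have [lxy|lxy] := lt _ _ xy.
  + by move=> /(pnc _ _ _ _ _ _ luv uv lxy xy s01 t01)[? ?]; subst.
  + rewrite (interp_rev (p y)) =>
      /(pnc _ _ _ _ _ _ luv uv lxy (sym _ _ xy) s01 (rev _ t01))[? ?].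
    by subst.
  + rewrite (interp_rev (p v)) =>
      /(pnc _ _ _ _ _ _ luv (sym _ _ uv) lxy xy (rev _ s01) t01)[? ?].
    by subst.
  + rewrite (interp_rev (p v)) (interp_rev (p y)) =>
      /(pnc _ _ _ _ _ _ luv (sym _ _ uv) lxy (sym _ _ xy) (rev _ s01) (rev _ t01))[? ?].
    by subst.
Qed.

(** * Segments between points on three rays *)

Lemma ltn_mod3 (x : nat) : (x %% 3 < 3)%N.
Proof. exact: ltn_pmod. Qed.

Lemma mod3_gap (x y : nat) : x = y %[mod 3] -> (x < y)%N -> (x + 3 <= y)%N.
Proof. lia. Qed.

(** Applied to residues mod 3 of the ends of two segments on the same rays: a single ray, or a
    common wedge crossed in the same or in opposite directions. *)
Lemma same_support (x y x' y' : nat) : (x == y') || (y == y') ->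
  (x == x') || (y == x') -> (x' == y) || (y' == y) -> (x' == x) || (y' == x) ->
  [\/ [/\ y = x, x' = x & y' = x], [/\ y != x, x = x' & y = y']
    | [/\ y != x, x = y', y = x' & x != x']].
Proof.
have [->|yx] := eqVneq y x; first by rewrite !orbb => /eqP-> /eqP-> _ _; constructor 1.
have [<-|xx] := eqVneq x x'; last first.
  by move=> + /eqP<- _; rewrite eq_sym => + /eqP<-; constructor 3; rewrite ?yx // eq_sym.
by move=> _ _; rewrite eq_sym (negbTE yx) => /eqP<- _; constructor 2.
Qed.

Section Spiral.
Variable R : realType.

(* The plane is identified with the boundary of the nonnegative octant of R^3 by
   projection along (1, 1, 1).  There the three rays are the coordinate axes, and
   [lift3 a b s] is a point of the segment from the corner [a] to the corner [b]. *)
Definition ray (a k : nat) : R := if (a %% 3)%N == k then a.+1%:R else 0.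
Definition lift3 (a b : nat) (s : R) (k : nat) : R := (1 - s) * ray a k + s * ray b k.
Definition spoke (a b : nat) (s : R) : R * R :=
  (lift3 a b s 0 - lift3 a b s 2, lift3 a b s 1 - lift3 a b s 2).

Lemma ray_ge0 a k : 0 <= ray a k.
Proof. by rewrite /ray; case: ifP. Qed.

Lemma lift3_ge0 a b s k : 0 <= s <= 1 -> 0 <= lift3 a b s k.
Proof.
by move=> /andP[s0 s1]; rewrite addr_ge0 ?mulr_ge0 ?ray_ge0 ?subr_ge0.
Qed.

Lemma lift3_zero a b s : exists2 k, (k < 3)%N & lift3 a b s k = 0.
Proof.
have [k [k3 ka kb]] : exists k, [/\ (k < 3)%N, (a %% 3)%N != k & (b %% 3)%N != k].
  have := ltn_mod3 a; have := ltn_mod3 b.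
  by move: (a %% 3)%N (b %% 3)%N => [|[|[|]]] // [|[|[|]]] // _ _;
    [exists 1%N|exists 2|exists 1%N|exists 2|exists 0%N|exists 0%N|exists 1%N|exists 0%N|exists 0%N].
by exists k => //; rewrite /lift3 /ray (negbTE ka) (negbTE kb) !mulr0 addr0.
Qed.

(* If the lifts differ, they differ by the same nonzero amount in all coordinates,
   but each of them has a vanishing coordinate. *)
Lemma spoke_lift3 a b s a' b' s' : 0 <= s <= 1 -> 0 <= s' <= 1 ->
  spoke a b s = spoke a' b' s' ->
  forall k, (k < 3)%N -> lift3 a b s k = lift3 a' b' s' k.
Proof.
move=> s01 s01' [e0 e1].
have [k k3 kz] := lift3_zero a b s; have [l l3 lz] := lift3_zero a' b' s'.
have p k := lift3_ge0 a b k s01; have p' k := lift3_ge0 a' b' k s01'.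
have h j : (j < 3)%N -> lift3 a b s j - lift3 a' b' s' j = lift3 a b s 0 - lift3 a' b' s' 0.
  by case: j => [|[|[|]]] // _; lra.
have hk := h k k3; have hl := h l l3; have := p l; have := p' k => ? ?.
by move=> j /h hj; lra.
Qed.

(** Hence any interior point of a segment reveals which rays carry its ends. *)
Lemma lift3_eq0 a b s k : 0 < s < 1 ->
  (lift3 a b s k == 0) = ((a %% 3)%N != k) && ((b %% 3)%N != k).
Proof.
move=> s01; rewrite /lift3 paddr_eq0 ?mulr_ge0 ?ray_ge0 //; try lra.
rewrite !mulf_eq0 /ray.
have /negbTE-> : 1 - s != 0 by rewrite gt_eqF //; lra.
have /negbTE-> : s != 0 by rewrite gt_eqF //; lra.
by do 2![case: ifP]; rewrite ?eqxx ?pnatr_eq0.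
Qed.

Lemma lift3_same a b s : (b %% 3)%N = (a %% 3)%N ->
  lift3 a b s (a %% 3)%N = (1 - s) * a.+1%:R + s * b.+1%:R.
Proof. by move=> ba; rewrite /lift3 /ray ba eqxx. Qed.

Lemma lift3_l a b s : (b %% 3)%N != (a %% 3)%N -> lift3 a b s (a %% 3)%N = (1 - s) * a.+1%:R.
Proof. by move=> /negbTE ba; rewrite /lift3 /ray ba eqxx mulr0 addr0. Qed.

Lemma lift3_r a b s : (b %% 3)%N != (a %% 3)%N -> lift3 a b s (b %% 3)%N = s * b.+1%:R.
Proof. by move=> ba; rewrite /lift3 /ray [_ == (b %% 3)%N]eq_sym (negbTE ba) eqxx mulr0 add0r. Qed.

(** In the coordinates of two rays, the segment with intercepts x and y consists of the points ((1 -
    s) x, s y). Larger intercepts push it outwards: the first equation gives s <= s', the second s'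
    <= s. *)
Lemma wedge_disjoint (x y x' y' s s' : R) : 0 < x -> 0 < y -> x <= x' -> y <= y' ->
  0 < s < 1 -> 0 < s' < 1 ->
  (1 - s) * x = (1 - s') * x' -> s * y = s' * y' -> [/\ x = x', y = y' & s = s'].
Proof.
move=> x0 y0 xx yy /andP[s0 s1] /andP[s0' s1'] e1 e2.
have ss : s <= s'.
  have : (1 - s') * x <= (1 - s) * x by rewrite e1 ler_wpM2l //; lra.
  by rewrite ler_pM2r //; lra.
have ss' : s' <= s.
  have : s' * y <= s * y by rewrite e2 ler_wpM2l //; lra.
  by rewrite ler_pM2r.
have E : s = s' by lra.
move: e1 e2; rewrite E => /mulfI -> // => [/mulfI->//|]; rewrite gt_eqF //; lra.
Qed.

Lemma spoke_inj a b s a' b' s' : (a < b <= a + 3)%N -> (a' < b' <= a' + 3)%N ->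
  0 < s < 1 -> 0 < s' < 1 -> spoke a b s = spoke a' b' s' ->
  [/\ a = a', b = b' & s = s'].
Proof.
move=> /andP[ab1 ab2] /andP[ab1' ab2'] s01 s01' H.
have {H}E k : (k < 3)%N -> lift3 a b s k = lift3 a' b' s' k.
  by apply: spoke_lift3 H _; lra.
have Z k : (k < 3)%N ->
    (a %% 3 == k)%N || (b %% 3 == k)%N = (a' %% 3 == k)%N || (b' %% 3 == k)%N.
  move=> k3; apply: negb_inj.
  by rewrite !negb_or -(lift3_eq0 _ _ _ s01) -(lift3_eq0 _ _ _ s01') E.
have Ea := E _ (ltn_mod3 a); have Eb := E _ (ltn_mod3 b).
have := Z _ (ltn_mod3 a); have := Z _ (ltn_mod3 b).
have := Z _ (ltn_mod3 a'); have := Z _ (ltn_mod3 b').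
rewrite !eqxx !orbT /= => {Z E} h1 h2 /esym h3 /esym h4.
have [[ba aa ba']|[ba aa bb]|[ba ab3 ba3 aa]] := same_support h1 h2 h3 h4.
(* Single ray: both segments have length 3 and start at congruent places. *)
- have bE : b = (a + 3)%N by apply/eqP; rewrite eqn_leq ab2; exact: mod3_gap.
  have bE' : b' = (a' + 3)%N by apply/eqP; rewrite eqn_leq ab2'; apply: mod3_gap => //; rewrite aa.
  move: Ea; rewrite lift3_same // -aa lift3_same ?aa // bE bE' -!addSn !natrD => e.
  have {}e : a.+1%:R + 3 * s = a'.+1%:R + 3 * s' by lra.
  have l1 : (a < a' + 3)%N by rewrite -ltnS -(ltr_nat R) -addSn natrD; lra.
  have l2 : (a' < a + 3)%N by rewrite -ltnS -(ltr_nat R) -addSn natrD; lra.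
  have aE : a = a'.
    case: (ltngtP a a') => // /mod3_gap; rewrite aa => /(_ erefl); first by rewrite leqNgt l2.
    by rewrite leqNgt l1.
  by split; [exact: aE|rewrite aE|move: e; rewrite aE; lra].
(* Same direction: the intercepts are ordered alike, since a <= a' and b' < b would give b' <= b - 3
   <= a <= a'. *)
- have ba' : (b' %% 3 != a' %% 3)%N by rewrite -bb -aa.
  rewrite lift3_l // aa lift3_l // in Ea; rewrite lift3_r // bb lift3_r // in Eb.
  have [le|le] := leqP a a'.
    have le' : (b <= b')%N.
      rewrite leqNgt; apply/negP => /mod3_gap-/(_ (esym bb)).
      by move: ab1' ab2 le; clear; lia.
    have [||||/eqP + /eqP +] := wedge_disjoint _ _ _ _ s01 s01' Ea Eb;
      rewrite ?ltr0n ?ler_nat //.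
    by rewrite !eqr_nat => /eqP[->] /eqP[->].
  have le' : (b' <= b)%N.
    rewrite leqNgt; apply/negP => /mod3_gap-/(_ bb).
    by move: ab1 ab2' le; clear; lia.
  have [||||/eqP + /eqP +] := wedge_disjoint _ _ _ _ s01' s01 (esym Ea) (esym Eb);
      rewrite ?ltr0n ?ler_nat //; first exact: ltnW.
  by rewrite !eqr_nat => /eqP[->] /eqP[->].
(* Opposite directions: [wedge_disjoint] would force a = b' and b = a', against a < b and a' <
   b'. *)
- have ba' : (b' %% 3 != a' %% 3)%N by rewrite -ab3 -ba3 eq_sym.
  rewrite lift3_l // ab3 lift3_r // in Ea; rewrite lift3_r // ba3 lift3_l // in Eb.
  have r01 : 0 < 1 - s' < 1 by lra.
  have {}Ea : (1 - s) * a.+1%:R = (1 - (1 - s')) * b'.+1%:R by rewrite Ea; ring.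
  have [le|le] := ltnP a b'.
    have le' : (b <= a')%N.
      (* Otherwise a' + 3 <= b <= a + 3 <= b' <= a' + 3, so that a = a'. *)
      rewrite leqNgt; apply/negP => /mod3_gap-/(_ (esym ba3)) g1.
      have g2 := mod3_gap ab3 le; move/eqP: aa; apply; congr (_ %% 3)%N.
      by move: g1 g2 ab2 ab2'; clear; lia.
    have [||||/eqP + /eqP +] := wedge_disjoint _ _ _ _ s01 r01 Ea Eb;
      rewrite ?ltr0n ?ler_nat //; first exact: ltnW.
    by rewrite !eqr_nat; move: ab1 ab1'; clear; lia.
  have le' : (a' <= b)%N by move: le ab1 ab1'; clear; lia.
  have [||||/eqP + /eqP +] := wedge_disjoint _ _ _ _ r01 s01 (esym Ea) (esym Eb);
      rewrite ?ltr0n ?ler_nat //.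
  by rewrite !eqr_nat; move: ab1 ab1'; clear; lia.
Qed.

(** The corner [c] is [spoke c d 0] for any [d]. It lies on one ray only, so the segment would run
    along that ray from a to a + 3, with no corner of the ray in between. *)
Lemma spoke_avoids_corner a b s c d : (a < b <= a + 3)%N -> 0 < s < 1 ->
  spoke a b s <> spoke c d 0.
Proof.
move=> /andP[ab1 ab2] s01 H.
have {H}E k : (k < 3)%N -> lift3 a b s k = ray c k.
  by move=> k3; rewrite (spoke_lift3 _ _ H) // /lift3; [ring|lra|lra].
have Z k : (k < 3)%N -> (a %% 3 == k)%N || (b %% 3 == k)%N = (c %% 3 == k)%N.
  move=> k3; apply: negb_inj; rewrite negb_or -(lift3_eq0 _ _ _ s01) E // /ray.
  by case: ifP; rewrite ?eqxx ?pnatr_eq0.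
have := Z _ (ltn_mod3 a); have := Z _ (ltn_mod3 b).
rewrite !eqxx orbT /= => /esym/eqP cb /esym/eqP ca.
have ba : (b %% 3 = a %% 3)%N by rewrite -cb ca.
have bE : b = (a + 3)%N by apply/eqP; rewrite eqn_leq ab2; exact: mod3_gap.
have := E _ (ltn_mod3 a); rewrite lift3_same // /ray ca eqxx bE -addSn natrD => e.
have l1 : (a < c)%N by rewrite -ltnS -(ltr_nat R); lra.
have l2 : (c < a + 3)%N by rewrite -ltnS -(ltr_nat R) -addSn natrD; lra.
by have := mod3_gap (esym ca) l1; rewrite leqNgt l2.
Qed.

Lemma corner_inj a b c d : spoke a b 0 = spoke c d 0 -> a = c.
Proof.
move=> /spoke_lift3-/(_ _ _)/= H.
have {H}E k : (k < 3)%N -> ray a k = ray c k.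
  by move=> k3; have := H _ _ k k3; rewrite /lift3 !subr0 !mul1r !mul0r !addr0; apply; lra.
have := E _ (ltn_mod3 a); rewrite /ray eqxx; case: ifP => _ /eqP.
  by rewrite eqr_nat => /eqP[].
by rewrite pnatr_eq0.
Qed.

End Spiral.

(** * The drawing of the layers *)

Section LayerDrawing.
Variables (R : realType) (G : nat).
Hypothesis G1 : (1 < G)%N.

(** Dividing by [G.-1] puts the first and last vertices of a layer exactly on its two corners. *)
Definition layer_point (m : nat) : R * R :=
  spoke (m %/ G).*2 (m %/ G).*2.+1 ((m %% G)%:R / G.-1%:R).

(* Even corners are first vertices of layers, odd ones are last vertices. *)
Definition corner (a : nat) : nat := (a./2 * G + odd a * G.-1)%N.

(* [edge_segment u v a b s t]: the edge uv is drawn as the part between the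
   parameters [s] and [t] of the segment from the corner [a] to the corner [b]. *)
Inductive edge_segment : nat -> nat -> nat -> nat -> R -> R -> Prop :=
| LayerEdge i j : (j.+1 < G)%N ->
    edge_segment (i * G + j)%N (i * G + j).+1%N i.*2 i.*2.+1
      (j%:R / G.-1%:R) (j.+1%:R / G.-1%:R)
| ChordEdge a b : (a < b <= a + 3)%N -> ~~ (~~ odd a && (b == a.+1)) ->
    edge_segment (corner a) (corner b) a b 0 1.

Lemma spoke1 (a b c : nat) : spoke a b 1 = spoke b c 0 :> R * R.
Proof. by rewrite /spoke /lift3 !subrr !subr0 !mul0r !mul1r !addr0 !add0r. Qed.

Lemma spoke0 (a b c : nat) : spoke a b 0 = spoke a c 0 :> R * R.
Proof. by rewrite /spoke /lift3 !mul0r. Qed.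

Lemma layer_pointE i j : (j < G)%N ->
  layer_point (i * G + j)%N = spoke i.*2 i.*2.+1 (j%:R / G.-1%:R).
Proof.
move=> jG; rewrite /layer_point divnMDl ?modnMDl; last lia.
by rewrite divn_small // addn0 modn_small.
Qed.

Lemma predG_neq0 : G.-1%:R != 0 :> R.
Proof. by rewrite pnatr_eq0; lia. Qed.

Lemma layer_point_corner a c : layer_point (corner a) = spoke a c 0.
Proof.
rewrite layer_pointE; last by case: odd; lia.
have := odd_double_half a; case: odd => /= aE; rewrite ?mul1n ?mul0n.
  by rewrite divff ?predG_neq0 // (spoke1 _ _ c); congr spoke; lia.
by rewrite mul0r (spoke0 _ _ c); congr spoke; lia.
Qed.

Lemma edge_segment_ends u v a b s t : edge_segment u v a b s t ->
  [/\ (a < b <= a + 3)%N, 0 <= s < t, t <= 1,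
    layer_point u = spoke a b s & layer_point v = spoke a b t].
Proof.
have Gp : 0 < G.-1%:R :> R by rewrite ltr0n; lia.
case=> [i j jG|{}a {}b ab _]; split=> //; try lia.
- by rewrite divr_ge0 //= ltr_pM2r ?invr_gt0 // ltr_nat.
- by rewrite ler_pdivrMr // mul1r ler_nat; lia.
- by rewrite layer_pointE //; lia.
- by rewrite -addnS layer_pointE.
- by rewrite lexx ltr01.
- exact: layer_point_corner.
- by rewrite (spoke1 _ _ b); exact: layer_point_corner.
Qed.

(** The corner indices differ by 1 for y x', by 2 for x x' and y y', and by 3 for x y'. *)
Lemma layer_arc_segment u v : (u < v)%N -> layer_arc G u v || layer_arc G v u ->
  exists a b s t, edge_segment u v a b s t.
Proof.
have ce i : corner i.*2 = (i * G)%N by rewrite /corner doubleK odd_double addn0.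
have co i : corner i.*2.+1 = (i * G + G.-1)%N.
  by rewrite /corner /= uphalf_double odd_double mul1n.
move=> uv uvA.
have : [\/ v = u.+1, (G %| u.+1)%N /\ v = (u + G)%N, (G %| u)%N /\ v = (u + G)%N
    | (G %| u)%N /\ v = (u + (2 * G).-1)%N].
  case/orP: uvA => /or4P[/eqP vE|/andP[d /eqP vE]|/andP[d /eqP vE]|/andP[d /eqP vE]];
    first [exact: Or41|exact: Or42|exact: Or43|exact: Or44|clear d; lia|lia].
have last_coord w : (G %| w.+1)%N -> exists i, w = (i * G + G.-1)%N.
  by move=> /dvdnP[[|i] wE]; [|exists i; rewrite mulSn in wE]; lia.
case=> [->|[/last_coord[i ->] ->]|[/dvdnP[i ->] ->]|[/dvdnP[i ->] ->]].
- have [uG|uG] := ltnP (u %% G).+1 G.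
    rewrite (divn_eq u G); do 4!eexists; exact: LayerEdge.
  have -> : u = corner (u %/ G).*2.+1.
    by rewrite co [LHS](divn_eq u G); have := ltn_pmod u (ltnW G1); lia.
  have -> : (corner (u %/ G).*2.+1).+1 = corner (u %/ G).+1.*2.
    by rewrite co ce mulSn; lia.
  by do 4!eexists; apply: ChordEdge; rewrite /= ?odd_double; lia.
- have -> : (i * G + G.-1 + G = corner i.+1.*2.+1)%N by rewrite co mulSn; lia.
  by rewrite -co; do 4!eexists; apply: ChordEdge; rewrite /= ?odd_double; lia.
- have -> : (i * G + G = corner i.+1.*2)%N by rewrite ce mulSn; lia.
  by rewrite -ce; do 4!eexists; apply: ChordEdge; rewrite /= ?odd_double; lia.
- have -> : (i * G + (2 * G).-1 = corner i.+1.*2.+1)%N by rewrite co mulSn; lia.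
  by rewrite -ce; do 4!eexists; apply: ChordEdge; rewrite /= ?odd_double; lia.
Qed.

(** The side condition of [ChordEdge] keeps chords off the segments of layers, and the edges of one
    layer occupy consecutive intervals of parameters. *)
Lemma edge_segment_disjoint u v u' v' a b a' b' s t s' t' r :
  edge_segment u v a b s t -> edge_segment u' v' a' b' s' t' ->
  a = a' -> b = b' -> s < r < t -> s' < r < t' -> u = u' /\ v = v'.
Proof.
have Gp : 0 < G.-1%:R :> R by rewrite ltr0n; lia.
case=> [i j jG|{}a {}b ab nab]; case=> [i' j' jG'|{}a' {}b' ab' nab'] aE bE.
- have -> : i = i' by lia.
  rewrite !ltr_pdivrMr // !ltr_pdivlMr // => /andP[l1 l2] /andP[l3 l4].
  have l5 : (j < j'.+1)%N by rewrite -(ltr_nat R); lra.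
  have l6 : (j' < j.+1)%N by rewrite -(ltr_nat R); lra.
  by have -> : j = j' by lia.
- by move: nab'; rewrite -aE -bE odd_double eqxx.
- by move: nab; rewrite aE bE odd_double eqxx.
- by rewrite aE bE.
Qed.

Lemma spoke_interp (a b : nat) (s t r : R) :
  interp (spoke a b s) (spoke a b t) r = spoke a b (s + (t - s) * r).
Proof. by rewrite /interp /spoke /lift3 /=; congr pair; ring. Qed.

Lemma affine_inside (s t r : R) : 0 <= s -> s < t -> t <= 1 -> 0 < r < 1 ->
  s < s + (t - s) * r < t /\ 0 < s + (t - s) * r < 1.
Proof.
move=> s0 st t1 /andP[r0 r1].
have h : 0 < (t - s) * r by rewrite mulr_gt0 // subr_gt0.
have h' : (t - s) * r < t - s by rewrite gtr_pMr // subr_gt0.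
by split; lra.
Qed.

Lemma layer_point_cases m :
  (exists a, m = corner a) \/
  (exists i j, [/\ m = (i * G + j)%N, (0 < j < G.-1)%N &
     0 < (j%:R / G.-1%:R : R) < 1]).
Proof.
have Gp : 0 < G.-1%:R :> R by rewrite ltr0n; lia.
have jG := ltn_pmod m (ltnW G1).
have [j0|j0] := eqVneq (m %% G)%N 0%N.
  left; exists (m %/ G).*2.
  by rewrite /corner doubleK odd_double addn0 [LHS](divn_eq m G) j0 addn0.
have [j1|j1] := eqVneq (m %% G)%N G.-1.
  left; exists (m %/ G).*2.+1.
  by rewrite /corner /= uphalf_double odd_double mul1n [LHS](divn_eq m G) j1.
right; exists (m %/ G)%N, (m %% G)%N; rewrite -divn_eq; split=> //; first lia.
by rewrite divr_gt0 ?ltr0n ?ltr_pdivrMr ?mul1r ?ltr_nat //; lia.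
Qed.

Lemma layer_point_inj : injective layer_point.
Proof.
have avoid a i j : (0 < j < G.-1)%N -> 0 < (j%:R / G.-1%:R : R) < 1 ->
    layer_point (i * G + j)%N <> layer_point (corner a).
  move=> jG j01; rewrite layer_pointE; last lia.
  by rewrite (layer_point_corner _ a); apply: spoke_avoids_corner => //; lia.
move=> m m'.
have [[a ->]|[i [j [-> jG j01]]]] := layer_point_cases m;
  have [[a' ->]|[i' [j' [-> jG' j01']]]] := layer_point_cases m'.
- by rewrite (layer_point_corner _ a) (layer_point_corner _ a) => /corner_inj ->.
- by move=> /esym /avoid; case.
- by move=> /avoid; case.
- rewrite !layer_pointE; [|lia|lia] => /spoke_inj[]//; try lia.
  move=> iE _ /mulIf -/(_ _)/eqP; rewrite eqr_nat.
  have -> : i = i' by lia.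
  by move=> /(_ _)/eqP-> //; rewrite invr_eq0 predG_neq0.
Qed.

Lemma layer_digraph_planar (n : nat) : planar R (layer_digraph G (n := n)).
Proof.
have [irr _] := layer_digraph_oriented n G1.
apply: (straight_line_planar (p := fun u => layer_point u)) => //.
- by move=> u v /layer_point_inj /val_inj.
- move=> u v w r uv uvA r01.
  have [a [b [s [t E]]]] := layer_arc_segment uv uvA.
  have [ab /andP[s0 st] t1 -> ->] := edge_segment_ends E; rewrite spoke_interp.
  have [rst r01'] := affine_inside s0 st t1 r01.
  have [[c ->]|[i [j [-> jG j01]]]] := layer_point_cases w.
    by rewrite (layer_point_corner _ c); exact: spoke_avoids_corner.
  have jG' : (j < G)%N by move: jG; clear; lia.
  rewrite layer_pointE // => /spoke_inj[]//; first by rewrite ltnSn -addn1 leq_add2l.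
  (* The edge now lies on the segment of the layer of [w], between consecutive multiples of 1 / (G -
     1), while [w] sits at such a multiple. *)
  case: E ab s0 st t1 rst r01' => [i' j' _|a' b' ab' nab'] _ _ _ _ rst _ aE bE.
    move: rst => /[swap] ->.
    have Gp : 0 < G.-1%:R :> R by rewrite ltr0n; lia.
    by rewrite !ltr_pM2r ?invr_gt0 // !ltr_nat; lia.
  by move: nab'; rewrite aE bE odd_double eqxx.
- move=> u v x y r r' uv uvA xy xyA r01 r01'.
  have [a [b [s [t E]]]] := layer_arc_segment uv uvA.
  have [a' [b' [s' [t' E']]]] := layer_arc_segment xy xyA.
  have [ab /andP[s0 st] t1 -> ->] := edge_segment_ends E.
  have [ab' /andP[s0' st'] t1' -> ->] := edge_segment_ends E'; rewrite !spoke_interp.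
  have [rst R01] := affine_inside s0 st t1 r01.
  have [rst' R01'] := affine_inside s0' st' t1' r01'.
  move=> /spoke_inj[]// aE bE rE; rewrite -rE in rst'.
  by have [/val_inj-> /val_inj->] := edge_segment_disjoint E E' aE bE rst rst'.
Qed.

End LayerDrawing.

Local Close Scope ring_scope.

Theorem theorem1 (R : realType) (n g : nat) (hg : (3 <= g)%N) (hn : (g <= n)%N) :
  (exists (V : finType) (e : rel V),
    [/\ #|V| = n, oriented e, planar R e, has_digirth e g
      & max_acyclic_size e (n - (n - 1) %/ (g - 1))%N]) /\
  ((n - (n - 1) %/ (g - 1))%N%:Z =
     Num.ceil ((n * (g - 2) + 1)%N%:R / (g - 1)%N%:R : rat))%R.
Proof.
have [G [gE G1 Gn]] : exists G, [/\ g = G.+1, 1 < G & G < n].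
  by exists g.-1; split; lia.
have -> : g - 2 = G - 1 by lia.
have -> : g - 1 = G by lia.
rewrite gE; split; last by apply: ceil_formula; lia.
exists 'I_n, (layer_digraph G (n := n)); split.
- exact: card_ord.
- exact: layer_digraph_oriented.
- exact: layer_digraph_planar.
- exact: layer_digraph_digirth.
- by apply: layer_digraph_max_acyclic => //; lia.
Qed.
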